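(* Let $G$ be a finite simple connected regular graph with at least $5$ vertices. Then the graph $\mathcal{R}(G):=L(L(G)^c)^c$ is a Ramanujan graph with diameter at most three.
   Context: All graphs are finite and simple. For a graph $H$, $H^c$ denotes its complement and $L(H)$ its line graph: the graph whose vertex set is $E(H)$, with two vertices adjacent if and only if the corresponding edges share a common endpoint in $H$. The eigenvalues of a graph are the eigenvalues of its adjacency matrix. A Ramanujan graph is a connected $k$-regular graph $H$ satisfying $\lambda^*(H)\le 2\sqrt{k-1}$, where $\lambda^*(H)$ is the largest absolute value of an eigenvalue of $H$ distinct from $k$ and $-k$. *)

(* Defs.v *)
From HB Require Import structures.
From mathcomp Require Import all_boot all_order all_algebra.
From mathcomp Require Import classical_sets reals.

Set Implicit Arguments.
Unset Strict Implicit.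
Unset Printing Implicit Defensive.

Import Order.TTheory GRing.Theory Num.Theory.

Record sgraph := SGraph {
  vertex :> finType;
  adj : rel vertex;
  adj_sym : symmetric adj;
  adj_irrefl : irreflexive adj }.

Definition edges (G : sgraph) : {set {set G}} :=
  [set e | [exists x : G, exists y : G, adj x y && (e == [set x; y])]].

Definition compl_adj (G : sgraph) : rel G :=
  fun x y => (x != y) && ~~ adj x y.

Fact compl_adj_sym (G : sgraph) : symmetric (@compl_adj G).
Proof. by move=> x y; rewrite /compl_adj eq_sym adj_sym. Qed.

Fact compl_adj_irrefl (G : sgraph) : irreflexive (@compl_adj G).
Proof. by move=> x; rewrite /compl_adj eqxx. Qed.

Definition compl (G : sgraph) : sgraph :=
  SGraph (@compl_adj_sym G) (@compl_adj_irrefl G).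

Definition line_adj (G : sgraph) : rel {e : {set G} | e \in edges G} :=
  fun e f => (e != f) && [exists x : G, (x \in val e) && (x \in val f)].

Fact line_adj_sym (G : sgraph) : symmetric (@line_adj G).
Proof.
move=> e f; rewrite /line_adj eq_sym; congr (_ && _).
by apply: eq_existsb => x; rewrite andbC.
Qed.

Fact line_adj_irrefl (G : sgraph) : irreflexive (@line_adj G).
Proof. by move=> e; rewrite /line_adj eqxx. Qed.

Definition line_graph (G : sgraph) : sgraph :=
  SGraph (@line_adj_sym G) (@line_adj_irrefl G).

Definition graph_connected (G : sgraph) : Prop :=
  0 < #|{: G}| /\ forall x y : G, connect (@adj G) x y.

Definition regular_of_degree (G : sgraph) (k : nat) : Prop :=
  forall x : G, #|[set y | adj x y]| = k.

Definition regular (G : sgraph) : Prop := exists k, regular_of_degree G k.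

(* If no walk joins x to y, the value is the otherwise impossible #|G|;
   a shortest walk has fewer than #|G| edges. *)
Definition gdist (G : sgraph) (x y : G) : nat :=
  find (fun n => [exists p : n.-tuple G, path (@adj G) x p && (last x p == y)])
       (iota 0 #|{: G}|).

Definition diameter (G : sgraph) : nat :=
  \max_(x : G) \max_(y : G) gdist x y.

Local Open Scope ring_scope.

Definition adjmx (R : realType) (G : sgraph) : 'M[R]_#|{: G}| :=
  \matrix_(i, j) (adj (enum_val i) (enum_val j))%:R.

(* The set is finite, so its supremum is its maximum; sup is 0 on the empty
   set.  The adjacency matrix is real symmetric, hence has only real
   eigenvalues. *)
Definition lambda_star (R : realType) (G : sgraph) (k : nat) : R :=
  sup [set `|a| | a in [set a : R |
        [/\ eigenvalue (adjmx R G) a, a <> k%:R & a <> - k%:R]]]%classic.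

Definition ramanujan (R : realType) (G : sgraph) : Prop :=
  graph_connected G /\
  exists k : nat, regular_of_degree G k /\
    lambda_star R G k <= 2 * Num.sqrt (k%:R - 1).

Definition calR (G : sgraph) : sgraph :=
  compl (line_graph (compl (line_graph G))).

(* Main.v *)
(* Let G be d-regular with m edges, H = L(G)^c, which is regular of degree
   r = m + 1 - 2d, and M = m r / 2 the number of edges of H; then R(G) = L(H)^c
   is regular of degree k = M + 1 - 2r.  On functions of sum zero, complementing
   a graph turns the eigenvalue t into -1 - t, and the vertex-edge incidence
   matrix N, with N^T N = A(L(H)) + 2 and N N^T = A(H) + r, carries an
   eigenvalue t <> -2 of L(H) to the eigenvalue t + 2 - r of H.  Since the
   spectrum of L(G) lies in [-2, 2d - 2], every eigenvalue a <> k of R(G) is 1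
   or satisfies -r <= a <= 2d - r, whence a^2 <= 2r(m - 4) = 4(k - 1).
   The distance bound (in fact at most 2) is a count: fewer than M edges of H
   meet three vertices two pairs of which are adjacent. *)
Require Import Defs.
From mathcomp Require Import all_boot all_order all_algebra.
From mathcomp Require Import reals.
From mathcomp Require Import boolp.
From mathcomp Require Import zify ring lra.

Import Order.TTheory GRing.Theory Num.Theory.

Lemma sum_card (T : finType) (P : pred T) : \sum_x (P x : nat) = #|[set x | P x]|.
Proof.
rewrite -sum1_card [RHS]big_mkcond /=.
by apply: eq_bigr => x _; rewrite inE; case: (P x).
Qed.

(** * Incidence counts for line graphs and complements *)

Section Incidence.

Variable G : sgraph.
Local Notation E := (vertex (line_graph G)).

Lemma edgesP (e : {set G}) :
  reflect (exists x y, adj x y /\ e = [set x; y]) (e \in edges G).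
Proof.
rewrite inE; apply: (iffP existsP) => [[x /existsP[y /andP[xy /eqP->]]]|[x [y [xy ->]]]].
  by exists x, y.
by exists x; apply/existsP; exists y; rewrite xy eqxx.
Qed.

Lemma adj_neq (x y : G) : adj x y -> x != y.
Proof. by apply: contraTneq => ->; rewrite adj_irrefl. Qed.

Lemma card_edge (e : E) : #|val e| = 2.
Proof.
by have /edgesP[x [y [xy ->]]] := valP e; rewrite cards2 adj_neq.
Qed.

Lemma edge_set2 (e : E) (x y : G) :
  x != y -> x \in val e -> y \in val e -> val e = [set x; y].
Proof.
move=> xy xe ye; apply/esym/eqP; rewrite eqEcard cards2 xy card_edge andbT.
by apply/subsetP => z; rewrite !inE => /orP[] /eqP->.
Qed.

Lemma set2_edges (x y : G) : x != y -> ([set x; y] \in edges G) = adj x y.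
Proof.
move=> xy; apply/edgesP/idP => [[u [v [uv eq_xy]]]|]; last by exists x, y.
have: x \in [set u; v] by rewrite -eq_xy set21.
have: y \in [set u; v] by rewrite -eq_xy set22.
rewrite !inE => /orP[]/eqP yE /orP[]/eqP xE; move: xy uv;
  by rewrite yE xE ?eqxx // adj_sym.
Qed.

(** Entrywise [N^T N = A(L(G)) + 2]: edges with two common vertices coincide, so distinct ones share
    at most one. *)
Lemma sum_incidence_vertices (e f : E) :
  \sum_x (x \in val e) * (x \in val f) = adj e f + 2 * (e == f).
Proof.
have -> : \sum_x (x \in val e) * (x \in val f) = #|val e :&: val f|.
  by rewrite -sum_card; apply: eq_bigr => x _; rewrite mulnb.
have [->|ef] := eqVneq e f; first by rewrite adj_irrefl setIid card_edge.
rewrite muln0 addn0 /= /line_adj ef /=.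
have lt2 : #|val e :&: val f| < 2.
  rewrite ltnNge; apply: contra ef => ge2; apply/eqP/val_inj.
  have /eqP <- : val e :&: val f == val e.
    by rewrite eqEcard subsetIl card_edge.
  by apply/eqP; rewrite eqEcard subsetIr card_edge.
case: existsP => [[x /andP[xe xf]]|nex].
  apply/anti_leq; rewrite -ltnS lt2 card_gt0 /=.
  by apply/set0Pn; exists x; rewrite inE xe.
apply/eqP; rewrite cards_eq0; apply/negbNE/set0Pn => -[x]; rewrite inE => xef.
by apply: nex; exists x.
Qed.

Lemma edges_at (x : G) :
  [set val e | e : E & x \in val e] = [set [set x; y] | y in [set y | adj x y]].
Proof.
apply/setP => s; apply/imsetP/imsetP => [[e]|[y]]; rewrite inE.
  move=> xe ->; have /edgesP[u [v [uv eE]]] := valP e.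
  move: xe; rewrite eE !inE => /orP[]/eqP ->; [exists v => // | exists u].
  - by rewrite inE.
  - by rewrite inE adj_sym.
  - by rewrite setUC.
move=> xy ->; have he : [set x; y] \in edges G by rewrite set2_edges ?adj_neq.
by exists (exist (fun s => s \in edges G) _ he); rewrite ?inE /= ?eqxx.
Qed.

Lemma card_edges_at (d : nat) (x : G) :
  regular_of_degree G d -> #|[set e : E | x \in val e]| = d.
Proof.
move=> regG; rewrite -[RHS](regG x) -(card_imset _ val_inj) edges_at.
rewrite card_in_imset // => y z; rewrite !inE => /adj_neq xy /adj_neq xz yz.
have: y \in [set x; z] by rewrite -yz set22.
by rewrite !inE eq_sym (negPf xy) => /eqP.
Qed.

(** Entrywise [N N^T = A(G) + d]: for [x != y], only the edge [[set x; y]] can contain both. *)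
Lemma sum_incidence_edges (d : nat) (x y : G) : regular_of_degree G d ->
  \sum_(e : E) (x \in val e) * (y \in val e) = adj x y + d * (x == y).
Proof.
move=> regG; have [<-|xy] := eqVneq x y.
  rewrite adj_irrefl muln1 add0n -(card_edges_at d x regG) -sum_card.
  by apply: eq_bigr => e _; rewrite mulnb andbb.
rewrite muln0 addn0; case: (boolP (adj x y)) => [axy|naxy].
  have he : [set x; y] \in edges G by rewrite set2_edges.
  rewrite (bigD1 (exist (fun s => s \in edges G) _ he)) //= set21 set22 big1 // => e.
  case: (boolP (x \in val e)) => [xe|]; last by rewrite mul0n.
  case: (boolP (y \in val e)) => [ye|]; last by rewrite muln0.
  by case/eqP; apply: val_inj; rewrite /= (edge_set2 e x y).
rewrite big1 // => e _; case: (boolP (x \in val e)) => [xe|]; last by rewrite mul0n.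
case: (boolP (y \in val e)) => [ye|]; last by rewrite muln0.
by move: naxy; rewrite -set2_edges // -(edge_set2 e x y) // (valP e).
Qed.

Lemma sum_edge (e : E) : \sum_x (x \in val e : nat) = 2.
Proof. by rewrite sum_card -(card_edge e); apply: eq_card => x; rewrite inE. Qed.

Lemma sum_star (d : nat) (x : G) : regular_of_degree G d ->
  \sum_(e : E) (x \in val e : nat) = d.
Proof. by move=> regG; rewrite sum_card (card_edges_at d). Qed.

Lemma handshake (d : nat) :
  regular_of_degree G d -> #|E| * 2 = #|G| * d.
Proof.
move=> regG; rewrite -!sum_nat_const.
under eq_bigr => e _ do rewrite -(sum_edge e).
by rewrite exchange_big /=; apply: eq_bigr => x _; rewrite (sum_star d).
Qed.

(** A row of [N^T N] sums to [2 * d], since both ends of an edge lie on [d] edges; the diagonal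
    entry 2 is then removed. *)
Lemma line_graph_regular (d : nat) : regular_of_degree G d ->
  regular_of_degree (line_graph G) (2 * d - 2).
Proof.
move=> regG e; rewrite -sum_card.
suff : \sum_f (adj e f : nat) + 2 = 2 * d by lia.
have {1}-> : 2 = \sum_f 2 * (e == f).
  rewrite (bigD1 e) //= eqxx big1 // => f; rewrite eq_sym => /negPf -> //.
rewrite -big_split /=.
under eq_bigr do rewrite -sum_incidence_vertices.
rewrite exchange_big /= -(sum_edge e) big_distrl /=; apply: eq_bigr => x _.
by rewrite -big_distrr /= (sum_star d).
Qed.

Lemma compl_degree (d : nat) (x : G) : regular_of_degree G d ->
  #|[set y : compl G | adj (x : compl G) y]| + d + 1 = #|G|.
Proof.
move=> regG; rewrite -(regG x) -!sum_card.
have -> : 1 = \sum_(y : G) (x == y).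
  rewrite (bigD1 x) //= eqxx big1 // => f; rewrite eq_sym => /negPf -> //.
rewrite -!big_split /= -sum1_card; apply: eq_bigr => y _.
rewrite /compl_adj; have [<-|] := eqVneq x y; first by rewrite adj_irrefl.
by case: (adj x y).
Qed.

Lemma compl_regular (d : nat) : regular_of_degree G d ->
  regular_of_degree (compl G) (#|G| - d - 1).
Proof. by move=> regG x; have := compl_degree d x regG; lia. Qed.

End Incidence.

(** * Eigenvalues of complements and line graphs *)

Section Spectrum.

Local Open Scope ring_scope.
Variable R : realType.

(** Functions on vertices replace row vectors indexed by ordinals; the zero function is allowed, so
    nonvanishing is stated separately. *)
Definition eigenfun (G : sgraph) (a : R) (f : G -> R) :=
  forall x, \sum_y (adj x y)%:R * f y = a * f x.

Lemma eigenvalue_eigenfun (G : sgraph) (a : R) : eigenvalue (adjmx R G) a ->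
  exists f, (exists x, f x != 0) /\ eigenfun G a f.
Proof.
case/eigenvalueP => v vA v0; exists (fun x => v 0 (enum_rank x)); split.
  by case/rV0Pn: v0 => i vi; exists (enum_val i); rewrite enum_valK.
move=> x; have /rowP/(_ (enum_rank x)) := vA; rewrite !mxE => <-.
rewrite (reindex _ (onW_bij _ (@enum_val_bij G))) /=; apply: eq_bigr => i _.
by rewrite mxE enum_valK enum_rankK adj_sym mulrC.
Qed.

Lemma sum_adjR (G : sgraph) (k : nat) (x : G) : regular_of_degree G k ->
  \sum_y (adj x y)%:R = k%:R :> R.
Proof. by move=> regG; rewrite -natr_sum sum_card regG. Qed.

(** Summing the eigenvalue equation over all vertices gives [a * S = k * S] for the total [S] of
    [f]. *)
Lemma eigenfun_sum0 (G : sgraph) (k : nat) (a : R) (f : G -> R) :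
  regular_of_degree G k -> eigenfun G a f -> a <> k%:R -> \sum_x f x = 0.
Proof.
move=> regG fa ak.
have : a * (\sum_x f x) = k%:R * \sum_x f x.
  rewrite big_distrr /=; under eq_bigr do rewrite -fa.
  rewrite exchange_big /= big_distrr /=; apply: eq_bigr => y _.
  by rewrite -big_distrl /=; under eq_bigr do rewrite adj_sym; rewrite (sum_adjR G k y regG).
by move/eqP; rewrite -subr_eq0 -mulrBl mulf_eq0 subr_eq0 => /orP[/eqP|/eqP].
Qed.

Lemma sum_deltaR (T : finType) (f : T -> R) (x : T) :
  \sum_y (x == y)%:R * f y = f x.
Proof.
rewrite (bigD1 x) //= eqxx mul1r big1 ?addr0 // => y.
by rewrite eq_sym => /negPf->; rewrite mul0r.
Qed.

(** The adjacency matrices of a graph and its complement add up with the identity to the all-ones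
    matrix, which kills [f]. *)
Lemma eigenfun_compl (G : sgraph) (a : R) (f : G -> R) :
  \sum_x f x = 0 -> eigenfun (compl G) a f -> eigenfun G (- 1 - a) f.
Proof.
move=> f0 fa x.
suff : \sum_y (adj x y)%:R * f y + f x + a * f x = 0 by lra.
have -> : a * f x = \sum_(y : G) (compl_adj x y)%:R * f y by rewrite -(fa x).
rewrite -(sum_deltaR G f x) -!big_split -[RHS]f0 /=; apply: eq_bigr => y _.
rewrite /compl_adj; have [<-|_] := eqVneq x y.
  by rewrite adj_irrefl /=; ring.
by case: (adj x y) => /=; ring.
Qed.

(** The eigenvalue equation is read at a vertex where the absolute value of [f] is largest. *)
Lemma eigenfun_le_degree (G : sgraph) (d : nat) (a : R) (f : G -> R) (x : G) :
  regular_of_degree G d -> eigenfun G a f -> f x != 0 -> `|a| <= d%:R.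
Proof.
move=> regG fa fx0.
have [z _ zmax] :=
  @Order.TotalTheory.arg_maxP _ _ G x xpredT (fun y => `|f y|) isT.
have fz : 0 < `|f z| by apply: lt_le_trans (zmax x isT); rewrite normr_gt0.
rewrite -(ler_pM2r fz) -normrM -fa -(sum_adjR G d z regG) mulr_suml.
apply: le_trans (ler_norm_sum _ _ _) _; apply: ler_sum => y _.
by rewrite normrM normr_nat ler_wpM2l //; apply: zmax.
Qed.

Section Line.
Variable G : sgraph.
Local Notation E := (vertex (line_graph G)).
Local Notation inc x e := ((x \in val (e : E))%:R : R).

Lemma line_graph_incidence (f : E -> R) (e : E) :
  \sum_x inc x e * (\sum_(g : E) inc x g * f g) =
  \sum_g (adj e g)%:R * f g + 2 * f e.
Proof.
under eq_bigr do rewrite mulr_sumr.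
rewrite exchange_big /= -(sum_deltaR E f e) mulr_sumr -big_split /=.
apply: eq_bigr => g _; rewrite mulrA -mulrDl -natrM -natrD -sum_incidence_vertices.
by rewrite natr_sum mulr_suml; apply: eq_bigr => x _; rewrite natrM mulrA.
Qed.

(** By [N^T N = A(L(G)) + 2], the squared norm of [N f] is [a + 2] times that of [f]. *)
Lemma eigenfun_line_ge (a : R) (f : E -> R) (e : E) :
  eigenfun (line_graph G) a f -> f e != 0 -> - 2 <= a.
Proof.
move=> fa fe0.
have ff : 0 < \sum_e f e * f e.
  rewrite (bigD1 e) //=; apply: ltr_pwDl; first by rewrite -expr2 exprn_even_gt0.
  by apply: sumr_ge0 => g _; rewrite -expr2 sqr_ge0.
suff : 0 <= (a + 2) * \sum_e f e * f e by rewrite pmulr_lge0 //; lra.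
have -> : (a + 2) * (\sum_e f e * f e) = \sum_x (\sum_(g : E) inc x g * f g) ^+ 2.
  transitivity (\sum_(g : E) f g * \sum_x inc x g * (\sum_(g : E) inc x g * f g)).
    rewrite mulr_sumr; apply: eq_bigr => g _.
    by rewrite line_graph_incidence fa; ring.
  under eq_bigr do rewrite mulr_sumr.
  rewrite exchange_big /=; apply: eq_bigr => x _; rewrite expr2 mulr_suml.
  by apply: eq_bigr => g _; ring.
by apply: sumr_ge0 => x _; rewrite sqr_ge0.
Qed.

(** The witness is [h = N f]. Since [N^T h = (a + 2) f], it cannot vanish, and applying [N] gives
    [(A + d) h = (a + 2) h]. Its total is twice that of [f], as every edge has two ends. *)
Lemma eigenfun_line (d : nat) (a : R) (f : E -> R) (e : E) :
  regular_of_degree G d -> eigenfun (line_graph G) a f -> \sum_(g : E) f g = 0 ->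
  f e != 0 -> a <> - 2 ->
  exists h : G -> R, [/\ exists x, h x != 0, \sum_x h x = 0 &
                         eigenfun G (a + 2 - d%:R) h].
Proof.
move=> regG fa f0 fe0 a2; pose h x := \sum_g inc x g * f g.
have hE g : \sum_x inc x g * h x = (a + 2) * f g.
  by rewrite line_graph_incidence fa; ring.
exists h; split.
- apply: contrapT => nex; have := hE e; rewrite big1 => [/esym/eqP|x _].
    by rewrite mulf_eq0 (negPf fe0) orbF addr_eq0 => /eqP.
  by have [->|hx] := eqVneq (h x) 0; [rewrite mulr0|case: nex; exists x].
- rewrite /h exchange_big /=; transitivity (\sum_(g : E) 2 * f g).
    by apply: eq_bigr => g _; rewrite -mulr_suml -natr_sum (sum_edge _ g).
  by rewrite -mulr_sumr f0 mulr0.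
move=> x; suff : \sum_y (adj x y)%:R * h y + d%:R * h x = (a + 2) * h x.
  by rewrite mulrBl => <-; rewrite addrK.
have -> : (a + 2) * h x = \sum_(g : E) inc x g * (\sum_y inc y g * h y).
  by rewrite {1}/h mulr_sumr; apply: eq_bigr => g _; rewrite hE; ring.
rewrite -(sum_deltaR G h x) mulr_sumr -big_split /=.
under [RHS]eq_bigr do rewrite mulr_sumr.
rewrite [RHS]exchange_big /=; apply: eq_bigr => y _.
rewrite mulrA -mulrDl -natrM -natrD -(sum_incidence_edges G d x y regG).
by rewrite natr_sum mulr_suml; apply: eq_bigr => g _; rewrite natrM mulrA.
Qed.

End Line.
End Spectrum.

(** * Degree and distance *)

(** If [d <= 1], a vertex with its neighbours is closed under adjacency, hence is the whole
    connected graph, of at most two vertices. *)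
Lemma degree_ge2 (G : sgraph) (d : nat) : graph_connected G ->
  regular_of_degree G d -> 2 < #|{: G}| -> 1 < d.
Proof.
move=> [G0 Gconn] regG; apply: contraTltn => d1; rewrite -leqNgt.
have [x _] := card_gt0P G0.
pose S := x |: [set y | adj x y].
have clS : closed (@adj G) (mem S).
  apply: (intro_closed (sym_connect_sym (@adj_sym G))) => y z yz.
  rewrite !inE => /orP[/eqP<-|xy]; first by rewrite yz orbT.
  have /card_le1_eqP yN : #|[set u | adj y u]| <= 1 by rewrite regG.
  by rewrite (yN z x) ?eqxx // inE // adj_sym.
have -> : #|{: G}| = #|S|.
  by apply: eq_card => y; rewrite -(closed_connect clS (Gconn x y)) !inE eqxx.
by apply: leq_trans (leq_card_setU _ _) _; rewrite cards1 regG.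
Qed.

Lemma gdist_le (G : sgraph) (x y : G) (p : seq G) :
  path (@adj G) x p -> last x p = y -> gdist x y <= size p.
Proof.
move=> xp py; rewrite leqNgt; apply/negP => lt_p.
have := before_find 0 lt_p; rewrite nth_iota; last first.
  (* [find] is at most the length of the list searched, so [size p] is a valid index into it. *)
  by apply: leq_trans lt_p _; rewrite -[X in _ <= X](size_iota 0) find_size.
by move/existsP; apply; exists (in_tuple p); rewrite xp py eqxx.
Qed.

(* Two intersecting edges ab and ac are both missed by some edge: at most
   r + (r - 1) + (r - 1) edges meet {a, b, c}. *)
Lemma common_disjoint_edge (H : sgraph) (r : nat)
    (p q : compl (line_graph H)) : regular_of_degree H r ->
  3 * r <= #|line_graph H| + 1 -> p != q -> ~~ adj p q ->
  exists s : compl (line_graph H), adj p s /\ adj s q.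
Proof.
move=> regH Hr pq; rewrite /= /compl_adj pq /= negbK /line_adj pq /=.
case/existsP => a /andP[ap aq].
have other (e : line_graph H) : a \in val e -> exists b, val e = [set a; b].
  have /edgesP[u [v [_ ->]]] := valP e.
  by rewrite !inE => /orP[]/eqP->; [exists v | exists u; rewrite setUC].
have [b pE] := other p ap; have [c qE] := other q aq.
pose star x := [set e : line_graph H | x \in val e].
have pb : p \in star b by rewrite inE pE set22.
have qc : q \in star c by rewrite inE qE set22.
have cstar x : #|star x| = r by apply: card_edges_at.
have cb : #|star b :\ p| = r.-1 by rewrite -(cstar b) (cardsD1 p (star b)) pb.
have cc : #|star c :\ q| = r.-1 by rewrite -(cstar c) (cardsD1 q (star c)) qc.
have r0 : 0 < r by rewrite -(cstar b) card_gt0; apply/set0Pn; exists p.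
have [s] : exists s, s \notin star a :|: (star b :\ p) :|: (star c :\ q).
  apply/existsP; rewrite -negb_forall; apply/negP => /forallP all_in.
  suff : #|line_graph H| <= r + r.-1 + r.-1 by lia.
  rewrite -(eq_card (fun s => all_in s : (s \in _) = (s \in predT))).
  apply: leq_trans (leq_card_setU _ _) _; rewrite cc leq_add2r.
  by apply: leq_trans (leq_card_setU _ _) _; rewrite cb cstar.
rewrite !inE !negb_or !negb_and !negbK => /andP[/andP[sa sb] sc].
(* [p] and [q] contain [a] while [s] does not, so removing them from the stars of [b] and [c] is
   harmless: [s] misses [a], [b] and [c]. *)
have sp : s != p by apply: contraNneq sa => ->.
have sq : s != q by apply: contraNneq sa => ->.
rewrite (negPf sp) /= in sb; rewrite (negPf sq) /= in sc.
exists s; rewrite /= /compl_adj /line_adj sq eq_sym sp /=.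
split; apply/existsPn => x.
  by rewrite pE !inE; apply/negP => /andP[/orP[]/eqP->]; rewrite ?(negPf sa) ?(negPf sb).
by rewrite qE !inE; apply/negP => /andP[xs /orP[]/eqP xE]; move: xs; rewrite xE ?(negPf sa) ?(negPf sc).
Qed.

Lemma compl_line_short_path (H : sgraph) (r : nat) (p q : compl (line_graph H)) :
  regular_of_degree H r -> 3 * r <= #|line_graph H| + 1 ->
  exists2 s, path (@adj (compl (line_graph H))) p s &
    last p s = q /\ size s <= 2.
Proof.
move=> regH Hr; have [->|pq] := eqVneq p q; first by exists [::].
have [apq|napq] := boolP (adj p q); first by exists [:: q] => //; apply/andP.
have [s [ps sq]] := common_disjoint_edge H r p q regH Hr pq napq.
by exists [:: s; q] => //; apply/and3P.
Qed.

(** * The eigenvalue estimate *)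

Section EigenvalueBound.

Local Open Scope ring_scope.

(** With [H = L(G)^c], [a] is traced back to [-1 - a] for [L(H)], [1 - a - r] for [H] and
    [a + r - 2] for [L(G)]. The passage from [L(H)] to [H] excludes [-1 - a = -2], that is
    [a = 1]. *)
Lemma eigenvalue_calR (R : realType) (G : sgraph) (d r k : nat) (a : R) :
  regular_of_degree G d -> (0 < d)%N ->
  regular_of_degree (compl (line_graph G)) r -> regular_of_degree (calR G) k ->
  eigenvalue (adjmx R (calR G)) a -> a <> k%:R ->
  a = 1 \/ - r%:R <= a <= 2 * d%:R - r%:R.
Proof.
move=> regG d0 regH regk /eigenvalue_eigenfun[f [[p fp0] fa]] ak.
have f0 := eigenfun_sum0 R _ _ _ _ regk fa ak.
have fL := eigenfun_compl R (line_graph (compl (line_graph G))) _ _ f0 fa.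
have [a1|a1] := pselect (a = 1); [by left | right].
have [|h [[e he0] h0 hH]] := eigenfun_line R _ r _ _ p regH fL f0 fp0; first lra.
have hL := eigenfun_compl R (line_graph G) _ _ h0 hH.
have := eigenfun_line_ge R _ _ _ e hL he0.
have := eigenfun_le_degree R (line_graph G) _ _ _ e (line_graph_regular _ _ regG) hL he0.
(* [0 < d] makes the truncated [2 * d - 2] a true difference. *)
rewrite ler_norml natrB ?natrM; last by lia.
by move=> /andP[_ h1] h2; apply/andP; split; lra.
Qed.

Lemma eigenvalue_bound (R : realType) (d r m M k : nat) (a : R) :
  (2 <= d)%N -> (5 * d <= m * 2)%N -> (r + 2 * d = m + 1)%N ->
  (M * 2 = m * r)%N -> (k + 2 * r = M + 1)%N ->
  a = 1 \/ - r%:R <= a <= 2 * d%:R - r%:R ->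
  `|a| <= 2 * Num.sqrt (k%:R - 1).
Proof.
move=> d2 md rE ME kE aE.
have d2R : 2 <= d%:R :> R by rewrite ler_nat.
(* This is [5 * d <= m * 2] after substituting [m = r + 2 * d - 1]. *)
have rd : d%:R + 2 <= 2 * r%:R :> R.
  by rewrite -natrD -natrM ler_nat; lia.
have kR : 4 * (k%:R - 1) = 2 * r%:R * (r%:R + 2 * d%:R - 5) :> R.
  have mR : m%:R = r%:R + 2 * d%:R - 1 :> R.
    by have := congr1 (fun n => n%:R : R) rE; rewrite /= natrD natrM natrD; lra.
  have MR : M%:R * 2 = m%:R * r%:R :> R by rewrite -!natrM ME.
  have kR : k%:R + 2 * r%:R = M%:R + 1 :> R.
    by have := congr1 (fun n => n%:R : R) kE; rewrite /= natrD natrM natrD.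
  by rewrite mR in MR; nra.
have a2 : a ^+ 2 <= 4 * (k%:R - 1).
  rewrite kR; case: aE => [->|/andP[ra ad]]; first by nra.
  (* For [a <= r] the claim reduces to [r + 4 * d >= 10]; otherwise [0 < a <= 2 * d - r] and [rd] is
     needed. Both estimates are equalities at [d = r = 2]. *)
  have [ar|ar] := lerP a r%:R.
    have : a ^+ 2 <= r%:R ^+ 2 by nra.
    by nra.
  have : a ^+ 2 <= (2 * d%:R - r%:R) ^+ 2 by nra.
  by nra.
rewrite -sqrtr_sqr.
have -> : 2 = Num.sqrt (2 ^+ 2) :> R by rewrite sqrtr_sqr ger0_norm.
by rewrite -sqrtrM ?sqr_ge0 // ler_wsqrtr // (le_trans a2) // expr2 -natrM.
Qed.

End EigenvalueBound.

Theorem theorem1p1 (R : realType) (G : sgraph)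
    (Gconn : graph_connected G) (Greg : regular G) (Gcard : 5 <= #|{: G}|) :
  ramanujan R (calR G) /\ diameter (calR G) <= 3.
Proof.
have [d regG] := Greg.
have d2 : 2 <= d by apply: degree_ge2 Gconn regG _; lia.
have mE := handshake G d regG.
have regH := compl_regular _ _ (line_graph_regular G d regG).
set H := compl (line_graph G) in regH.
set m := #|line_graph G| in mE regH.
set r := m - _ - _ in regH.
have ME : #|line_graph H| * 2 = m * r := handshake H r regH.
have regR : regular_of_degree (calR G) _ :=
  compl_regular _ _ (line_graph_regular H r regH).
set M := #|line_graph H| in ME regR.
set k := M - _ - _ in regR.
(* The hypothesis of five vertices enters here; it makes the truncated subtractions in [r] exact and
   forces [2 <= r]. *)
have md : 5 * d <= m * 2 by rewrite mE leq_mul2r Gcard orbT.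
have rE : r + 2 * d = m + 1 by rewrite /r; lia.
have r2 : 2 <= r by lia.
(* As [M = m * r / 2], six edges suffice. With [m = 5], the bound [md] leaves [d = r = 2] and
   [M = 5], the five-cycle, where equality holds. *)
have Mr : 3 * r <= M + 1.
  have [m6|m5] : 6 <= m \/ m = 5 by lia.
    by nia.
  by rewrite m5 in ME rE; lia.
have kE : k + 2 * r = M + 1 by rewrite /k; lia.
have short (p q : calR G) := compl_line_short_path H r p q regH Mr.
split; last first.
  apply/bigmax_leqP => p _; apply/bigmax_leqP => q _.
  have [s ps [sq s2]] := short p q.
  by apply: leq_trans (gdist_le _ _ _ _ ps sq) _; apply: leq_trans s2 _.
split.
  split; first by change (0 < M); lia.
  by move=> p q; have [s ps [<- _]] := short p q; apply/connectP; exists s.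
exists k; split=> //; rewrite /lambda_star.
set S := classical_sets.image _ _.
have ubS : classical_sets.ubound S (2 * Num.sqrt (k%:R - 1))%R.
  move=> _ [a [aR ak _] <-].
  apply: (eigenvalue_bound R d r m M k) => //.
  by apply: eigenvalue_calR regG _ regH regR aR ak; lia.
(* For empty [S], [sup] takes its default value 0, and the bound is nonnegative. *)
have [S0|S0] := pselect (classical_sets.nonempty S); first exact: ge_sup.
rewrite sup_out; last by case.
by rewrite mulr_ge0 ?sqrtr_ge0.
Qed.
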